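(* Let $n\ge 0$ and $k\ge 1$ be integers, and let $T$ be the triangle with vertices $(F_n,F_{n+k})$, $(F_{n+2k},F_{n+3k})$, $(F_{n+4k},F_{n+5k})$. Then the area of $T$ equals $\dfrac{5F_k^4L_k}{2}$ if $k$ is even, and $\dfrac{F_k^2L_k^3}{2}$ if $k$ is odd.
   Context: $F_n$ denotes the Fibonacci numbers ($F_0=0$, $F_1=1$, $F_{n+1}=F_n+F_{n-1}$) and $L_n$ the Lucas numbers ($L_0=2$, $L_1=1$, $L_{n+1}=L_n+L_{n-1}$). The area of the triangle with vertices $(x_1,y_1),(x_2,y_2),(x_3,y_3)$ is $\frac12\left|(x_2-x_1)(y_3-y_1)-(x_3-x_1)(y_2-y_1)\right|$. *)

(* Defs.v *)
From mathcomp Require Import all_boot all_order all_algebra.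

Set Implicit Arguments.
Unset Strict Implicit.
Unset Printing Implicit Defensive.

Import Order.TTheory GRing.Theory Num.Theory.

Fixpoint fib (n : nat) : nat :=
  match n with
  | 0 => 0
  | 1 => 1
  | (m.+1 as p).+1 => fib p + fib m
  end.

Fixpoint lucas (n : nat) : nat :=
  match n with
  | 0 => 2
  | 1 => 1
  | (m.+1 as p).+1 => lucas p + lucas m
  end.

Local Open Scope ring_scope.

Definition triangle_area (R : realFieldType) (p1 p2 p3 : R * R) : R :=
  2^-1 * `|(p2.1 - p1.1) * (p3.2 - p1.2) - (p3.1 - p1.1) * (p2.2 - p1.2)|.

(* Main.v *)
(** Writing [q = (-1)^k], Fibonacci numbers along an arithmetic progression of
    step [k] satisfy [F_(m+2k) = L_k F_(m+k) - q F_m].  The determinant defining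
    the area is therefore a quadratic form in [x = F_n] and [y = F_(n+k)], and it
    is a multiple of the invariant form [y^2 - L_k x y + q x^2 = (-1)^n F_k^2] of
    this recurrence.  The other factor is [L_k (L_k^2 - 4)] for even [k] and
    [L_k^3] for odd [k]; finally [L_k^2 = 5 F_k^2 + 4 q]. *)
Require Import Defs.
From mathcomp Require Import all_boot all_order all_algebra.
From mathcomp Require Import ring zify.

Import Order.TTheory GRing.Theory Num.Theory.
Local Open Scope ring_scope.

Lemma fibSS n : fib n.+2 = (fib n.+1 + fib n)%N.
Proof. by []. Qed.

Lemma fib_add m k :
  fib (m + k.+1) = (fib k.+1 * fib m.+1 + fib k * fib m)%N.
Proof.
elim: m k => [|m IHm] k; first by rewrite /= !muln0 muln1 addn0.
by rewrite addSnnS IHm !fibSS; lia.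
Qed.

Lemma lucasS n : lucas n.+1 = (fib n.+2 + fib n)%N.
Proof.
suff [] : lucas n.+1 = (fib n.+2 + fib n)%N /\
          lucas n.+2 = (fib n.+3 + fib n.+1)%N by [].
elim: n => [//|n [IH1 IH2]]; split=> //.
have -> : lucas n.+3 = (lucas n.+2 + lucas n.+1)%N by [].
by rewrite IH1 IH2 !fibSS; lia.
Qed.

Section FibonacciRing.
Variable R : comNzRingType.

(** Cassini's identity, used from right to left: it trades a sign for a polynomial in two
    consecutive Fibonacci numbers, so that the identities below fall to [ring]. *)
Lemma fib_cassini n :
  (fib n.+1)%:R ^+ 2 - (fib n.+1)%:R * (fib n)%:R - (fib n)%:R ^+ 2
  = (-1) ^+ n :> R.
Proof.
elim: n => [|n IHn]; first by rewrite /= expr0; ring.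
by rewrite (exprS (-1)) -IHn fibSS natrD; ring.
Qed.

Lemma fib_step m k : (0 < k)%N ->
  (fib (m + 2 * k))%:R
  = (lucas k)%:R * (fib (m + k))%:R - (-1) ^+ k * (fib m)%:R :> R.
Proof.
case: k => // k _; rewrite mul2n -addnn addnA (exprS (-1)) -fib_cassini.
(* Two uses of the addition formula leave only [fib m], [fib m.+1], [fib k] and [fib k.+1]. *)
rewrite (fib_add (m + k.+1)) -addSn !fib_add lucasS !fibSS !(natrD, natrM).
ring.
Qed.

Lemma fib_step_form n k : (0 < k)%N ->
  (fib (n + k))%:R ^+ 2 - (lucas k)%:R * (fib n)%:R * (fib (n + k))%:R
    + (-1) ^+ k * (fib n)%:R ^+ 2
  = (-1) ^+ n * (fib k)%:R ^+ 2 :> R.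
Proof.
case: k => // k _; rewrite (exprS (-1)) -!fib_cassini fib_add lucasS !fibSS.
by rewrite !(natrD, natrM); ring.
Qed.

Lemma lucas_sqr k : (0 < k)%N ->
  (lucas k)%:R ^+ 2 = 5 * (fib k)%:R ^+ 2 + 4 * (-1) ^+ k :> R.
Proof.
case: k => // k _; rewrite (exprS (-1)) -fib_cassini lucasS fibSS !natrD; ring.
Qed.

End FibonacciRing.

Theorem theorem2p1 (R : realFieldType) (n k : nat) (hk : (1 <= k)%N) :
  let A : R * R := ((fib n)%:R, (fib (n + k))%:R) in
  let B : R * R := ((fib (n + 2 * k))%:R, (fib (n + 3 * k))%:R) in
  let C : R * R := ((fib (n + 4 * k))%:R, (fib (n + 5 * k))%:R) in
  (~~ odd k ->
     triangle_area A B C = 5 * (fib k)%:R ^+ 4 * (lucas k)%:R / 2) /\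
  (odd k ->
     triangle_area A B C = (fib k)%:R ^+ 2 * (lucas k)%:R ^+ 3 / 2).
Proof.
move=> A B C; rewrite /triangle_area /A /B /C /=.
have step m : (fib (n + m.+2 * k))%:R = (lucas k)%:R * (fib (n + m.+1 * k))%:R
    - (-1) ^+ k * (fib (n + m * k))%:R :> R.
  have := fib_step R (n + m * k) k hk.
  by rewrite -!addnA -mulnDl addn2 -mulSnr.
rewrite (step 3) (step 2) (step 1) (step 0) mul1n mul0n addn0.
have form := fib_step_form R n k hk; have sqr := lucas_sqr R k hk.
(* With exponent [odd k], the parity hypothesis evaluates the sign to 1 or -1. *)
move: form sqr; rewrite -(signr_odd _ k).
set x := (fib n)%:R; set y := (fib (n + k))%:R.
set a := (fib k)%:R; set l := (lucas k)%:R.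
have a0 : 0 <= a by apply: ler0n.
have l0 : 0 <= l by apply: ler0n.
move=> form sqr; split=> par;
  rewrite ?(negbTE par) ?par ?expr0 ?expr1 in form sqr *.
(* The sign [(-1) ^+ n] is the orientation of the triangle; the absolute value removes it. *)
- rewrite [X in `|X|](_ : _ = (-1) ^+ n * (5 * a ^+ 4 * l)).
    by rewrite normrMsign ger0_norm 1?mulrC // !mulr_ge0 ?exprn_ge0 ?ler0n.
  (* Here [sqr] makes [l ^+ 2 - 4] equal to [5 * a ^+ 2], and [form] supplies the other [a ^+ 2]. *)
  transitivity ((y ^+ 2 - l * x * y + 1 * x ^+ 2) * (l * (l ^+ 2 - 4))).
    by ring.
  by rewrite form sqr; ring.
- rewrite [X in `|X|](_ : _ = (-1) ^+ n * (a ^+ 2 * l ^+ 3)).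
    by rewrite normrMsign ger0_norm 1?mulrC // !mulr_ge0 ?exprn_ge0.
  (* For q = -1, F_(m+2k) - F_m = L_k F_(m+k), so each coordinate difference is a multiple of
     [l]. *)
  transitivity ((y ^+ 2 - l * x * y + -1 * x ^+ 2) * l ^+ 3); first by ring.
  by rewrite form; ring.
Qed.
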